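(* Let $X$ be a Banach space and let $\{V_n\}_{n\in\mathbb{N}}$ be a nested sequence of linear subspaces of $X$ such that $\overline{V_n}\subsetneq V_{n+1}$ for every $n\in\mathbb{N}$. Let $\{e_n\}_{n\in\mathbb{N}}$ be a decreasing sequence of positive numbers tending to $0$. Then there exists $x\in X$ such that for every $n\in\mathbb{N}$ $$\frac{e_n}{2}\leq \mathrm{dist}(x,V_n)\leq 2e_n.$$
   Context: $\mathbb{N}=\{1,2,\dots\}$. Closures are in the norm topology and $\mathrm{dist}(x,V)=\inf\{\|x-v\|:v\in V\}$. *)

(* Defs.v *)
From HB Require Import structures.
From mathcomp Require Import all_boot all_order all_algebra.
From mathcomp Require Import all_classical all_reals all_analysis.

Set Implicit Arguments.
Unset Strict Implicit.
Unset Printing Implicit Defensive.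

Import Order.TTheory GRing.Theory Num.Theory.
Import numFieldNormedType.Exports.

Local Open Scope classical_set_scope.
Local Open Scope ring_scope.

(* A Banach space is a [completeNormedModType R] over the reals [R]. This also
   covers complex Banach spaces: restricting scalars to [R] changes neither
   the norm, the closures nor the distances, and complex linear subspaces are
   in particular real linear subspaces. *)

Definition linear_subspace (R : realType) (X : normedModType R) (V : set X) :
  Prop := GRing.submod_closed (mem V).

(* [inf] is the infimum in [R] (with the junk value 0 for [V = set0], which
   is never a linear subspace). *)
Definition dist (R : realType) (X : normedModType R) (x : X) (V : set X) : R :=
  inf [set `|x - v| | v in V].

(* Main.v *)
Require Import Defs.
From HB Require Import structures.
From mathcomp Require Import all_boot all_order all_algebra.
From mathcomp Require Import all_classical all_reals all_analysis.
From mathcomp Require Import lra.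

Set Implicit Arguments.
Unset Strict Implicit.
Unset Printing Implicit Defensive.

Import Order.TTheory GRing.Theory Num.Theory.
Import numFieldNormedType.Exports.

Local Open Scope classical_set_scope.
Local Open Scope ring_scope.

(** The indices are cut into consecutive blocks [s j <= n < s j.+1]: a new block
starts as soon as [e] has dropped below half of its value [e (s j)] at the
start of the current block.  With [a j := e (s j) / 2] and
[W j := V (s j.+1).-1], the largest subspace of the block, it is enough to
find [x] such that every [n] in block [j] satisfies
[a j <= dist x (V n) <= 2 * a j], because [e n / 2 <= a j <= e n] there.

The vector [x] is a limit of finite combinations [\sum_j c j *: q j], where
[q j] lies in [V (s j.+1)], is at distance at least 1 from [W j], and has norm
barely more than 1 ([riesz]).  All the [q i] with [i < j] lie in every [V n]
of block [j], so only the terms from [j] on count for [dist x (V n)].  The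
coefficients are chosen from the last one down to the first so that the
distance to each [W j] is exactly [a j], with [`|c j| <= a j]
([dist_adjust], [prescribed_dist]).  This is possible as long as the terms
after [j] have total norm at most [a j].

For this argument the constants 1/2 and 2 leave no slack, but the blocks give the
strict inequality [2 * a j.+1 < a j].  Hence the norm of [q j] can be taken so
close to 1 that [a j * `|q j| <= 2 * a j - 2 * a j.+1].  These bounds
telescope: the terms from [j] on have total norm at most [2 * a j].  This gives
the upper bound for the distance in block [j], and also the condition needed
for the choice of the coefficients, as [2 * a j.+1 <= a j].

The coefficients depend on the number [m] of terms.  Each one stays in a
compact interval and the tails are uniformly small, so the combinations
converge in norm along an ultrafilter refining [m --> \oo]
([ultra_series_cvg]), and the distances converge with them
([dist_continuous]). *)

(** * Linear subspaces *)

Section LinearSubspace.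
Context (R : realType) (X : normedModType R) (V : set X).
Hypothesis V_sub : linear_subspace V.

Lemma subspace0 : V 0.
Proof. by case: V_sub => /set_mem. Qed.

Lemma subspaceZD a u v : V u -> V v -> V (a *: u + v).
Proof.
by move=> Vu Vv; case: V_sub => _ /(_ a u v) H; apply/set_mem/H; exact: mem_set.
Qed.

Lemma subspaceZ a u : V u -> V (a *: u).
Proof. by move=> Vu; rewrite -[_ *: _]addr0; apply: subspaceZD (subspace0). Qed.

Lemma subspaceD u v : V u -> V v -> V (u + v).
Proof. by move=> Vu; rewrite -{1}[u]scale1r; exact: subspaceZD. Qed.

Lemma subspaceN u : V u -> V (- u).
Proof. by rewrite -scaleN1r; exact: subspaceZ. Qed.

Lemma subspace_sum (I : eqType) (r : seq I) (F : I -> X) :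
  (forall i, i \in r -> V (F i)) -> V (\sum_(i <- r) F i).
Proof.
move=> VF; rewrite big_seq_cond; elim/big_rec: _ => [|i x].
  exact: subspace0.
by rewrite andbT => /VF ? ?; exact: subspaceD.
Qed.

End LinearSubspace.

(** * Distance to a set and to a subspace *)

Section Distance.
Context (R : realType) (X : normedModType R).
Implicit Types (V W : set X) (x y v : X).

Lemma dist_le V x v : V v -> dist x V <= `|x - v|.
Proof.
by move=> Vv; apply: ge_inf; [exists 0 => _ [w _ <-] | exists v].
Qed.

Lemma le_dist V x c :
  V !=set0 -> (forall v, V v -> c <= `|x - v|) -> c <= dist x V.
Proof.
move=> [v Vv] cV; apply: lb_le_inf; first by exists `|x - v|, v.
by move=> _ [w Vw <-]; exact: cV.
Qed.

Lemma dist_lt_ex V x c :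
  V !=set0 -> dist x V < c -> exists2 v, V v & `|x - v| < c.
Proof.
move=> V0 xc; apply/not_exists2P => xV; move: xc; apply/negP; rewrite -leNgt.
by apply: le_dist => // v Vv; case: (xV v) => // /negP; rewrite -leNgt.
Qed.

Lemma distS V W x : V !=set0 -> V `<=` W -> dist x W <= dist x V.
Proof. by move=> V0 VW; apply: le_dist => // v /VW; exact: dist_le. Qed.

Lemma dist_lipschitz V x y : V !=set0 -> dist x V <= `|x - y| + dist y V.
Proof.
move=> V0; rewrite -lerBlDl; apply: le_dist => // v Vv.
by rewrite lerBlDl (le_trans (dist_le _ Vv))// ler_distD.
Qed.

Lemma dist_continuous V : V !=set0 -> continuous (fun x : X => dist x V).
Proof.
move=> V0 x; apply/cvgrPdist_le => e e0; near=> y.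
have xy : `|x - y| <= e by near: y; apply: cvgr_dist_le => //; exact: cvg_id.
have := dist_lipschitz x y V0; have := dist_lipschitz y x V0.
by rewrite [`|y - x|]distrC ler_norml; lra.
Unshelve. all: by end_near. Qed.

Lemma dist_gt0 V x : V !=set0 -> ~ closure V x -> 0 < dist x V.
Proof.
move=> V0; apply: contra_notP => /negP; rewrite -leNgt => d0 B.
rewrite -nbhs_ballE => -[r /= r0 rB].
have [v Vv xv] := dist_lt_ex V0 (le_lt_trans d0 r0).
by exists v; split => //; apply: rB; rewrite -ball_normE.
Qed.

Section DistanceToSubspace.
Variable V : set X.
Hypothesis V_sub : linear_subspace V.

Lemma subspace_neq0 : V !=set0.
Proof. by exists 0; exact: subspace0. Qed.

Lemma dist_le_norm x : dist x V <= `|x|.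
Proof. by rewrite -{2}[x]subr0; apply: dist_le; exact: subspace0. Qed.

Lemma distD x y : dist (x + y) V <= dist x V + dist y V.
Proof.
rewrite -lerBlDr; apply: le_dist subspace_neq0 _ => v Vv.
rewrite lerBlDr -lerBlDl; apply: le_dist subspace_neq0 _ => w Vw.
rewrite lerBlDl (le_trans (dist_le _ (subspaceD V_sub Vv Vw)))//.
by rewrite opprD addrACA ler_normD.
Qed.

Lemma distZ c x : `|c| * dist x V <= dist (c *: x) V.
Proof.
have [->|c0] := eqVneq c 0.
  rewrite normr0 mul0r; apply: le_dist subspace_neq0 _ => v _; exact: normr_ge0.
apply: le_dist subspace_neq0 _ => v Vv.
have -> : c *: x - v = c *: (x - c^-1 *: v).
  by rewrite scalerBr scalerA divff// scale1r.
rewrite normrZ ler_wpM2l//; apply: dist_le; exact: subspaceZ.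
Qed.

(** Replacing [x] by [- x] gives the reverse inequality. *)
Lemma distN_le x : dist x V <= dist (- x) V.
Proof. by have := distZ (-1) x; rewrite normrN1 mul1r scaleN1r. Qed.

(** Adding a vector of [V] only permutes the competitors in the infimum. *)
Lemma dist_translate w x : V w -> dist (w + x) V = dist x V.
Proof.
have le z y : V z -> dist (z + y) V <= dist y V.
  move=> Vz; apply: le_trans (distD z y) _.
  by rewrite gerDr (le_trans (dist_le _ Vz))// subrr normr0.
move=> Vw; apply/eqP; rewrite eq_le le//=.
by rewrite -{1}(addKr w x) le//; exact: subspaceN.
Qed.

(** Riesz's lemma, normalized by the distance to [V] instead of the norm: if [v]
almost realizes the distance [d] from [u] to [V], then [u - v] still has
distance [d], and its norm is close to [d]; it remains to divide by [d]. *)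
Lemma riesz u (t : R) : ~ closure V u -> 1 < t ->
  exists v b, [/\ V v, 1 <= dist (b *: (u - v)) V & `|b *: (u - v)| <= t].
Proof.
move=> /(dist_gt0 subspace_neq0) d0 t1; set d := dist u V in d0.
have [v Vv uv] : exists2 v, V v & `|u - v| < t * d.
  by apply: dist_lt_ex subspace_neq0 _; rewrite ltr_pMl.
exists v, d^-1; split=> //.
  apply: le_trans (distZ _ _).
  rewrite addrC (dist_translate _ (subspaceN V_sub Vv)).
  by rewrite ger0_norm ?invr_ge0 ?(ltW d0)// mulVf ?gt_eqF.
by rewrite normrZ ger0_norm ?invr_ge0 ?(ltW d0)// mulrC ler_pdivrMr// ltW.
Qed.

(** Along the line [c *: q + y] the distance to [V] is at most [a] for [c = 0].
It is at least [a] for [c = a] or for [c = - a], since [(2 * a) *: q], the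
difference of these two points, is at distance at least [2 * a] from [V].  The
intermediate value theorem applies on that side.  The freedom of sign is what
gives the bound [a] for [`|c|]: with a prescribed sign, the triangle
inequality would only give [2 * a]. *)
Lemma dist_adjust y q (a : R) : 1 <= dist q V -> dist y V <= a ->
  exists2 c, `|c| <= a & dist (c *: q + y) V = a.
Proof.
move=> q1 ya.
have a0 : 0 <= a.
  by apply: le_trans ya; apply: le_dist subspace_neq0 _ => v _; exact: normr_ge0.
suff [b ba ab] : exists2 b : R, `|b| = a & a <= dist (b *: q + y) V.
  have [||t] := @IVT R (fun t => dist ((t * b) *: q + y) V) 0 1 a ler01.
  - apply: continuous_subspaceT => t.
    apply: (@continuous_comp _ _ _ (fun t : R => (t * b) *: q + y)
      (fun x => dist x V)); last exact: dist_continuous subspace_neq0 _.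
    apply: cvgD; last exact: cvg_cst.
    by apply: cvgZr_tmp; apply: cvgMr_tmp; exact: cvg_id.
  - rewrite mul0r scale0r add0r mul1r.
    by rewrite ge_min ya le_max ab orbT.
  rewrite in_itv/= => /andP[t0 t1] ta; exists (t * b) => //.
  by rewrite normrM ba (ger0_norm t0) ler_piMl.
have : 2 * a <= dist (a *: q + y) V + dist (- a *: q + y) V.
  have -> : 2 * a = `|2 * a| by rewrite ger0_norm// mulr_ge0.
  apply: le_trans (_ : `|2 * a| * dist q V <= _); first by rewrite ler_peMr.
  apply: le_trans (distZ _ _) _.
  have -> : (2 * a) *: q = (a *: q + y) + - (- a *: q + y).
    rewrite opprD -scaleNr opprK addrACA subrr addr0 -scalerDl.
    by rewrite mulr_natl mulr2n.
  apply: le_trans (distD _ _) _; rewrite lerD2l.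
  by apply: le_trans (distN_le _) _; rewrite opprK.
have [?|?] := leP a (dist (a *: q + y) V).
  by exists a => //; rewrite ger0_norm.
by exists (- a); rewrite ?normrN ?ger0_norm//; lra.
Qed.

End DistanceToSubspace.
End Distance.

Lemma sum_le_telescope (R : realType) (X : normedModType R) (z : nat -> X)
    (b : nat -> R) k m :
  (forall j, `|z j| <= b j - b j.+1) -> (forall j, 0 <= b j) ->
  `|\sum_(k <= j < m) z j| <= b k.
Proof.
move=> zb b0; apply: le_trans (ler_norm_sum _ _ _) _.
apply: le_trans (ler_sum _ (fun j _ => zb j)) _.
have [km|/ltnW mk] := leqP k m; last by rewrite big_geq.
rewrite (eq_bigr (fun j => (- b j.+1) - (- b j))); last first.
  by move=> j _; rewrite opprK addrC.
by rewrite telescope_sumr// opprK addrC gerBl.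
Qed.

(** The induction removes the first index, so the coefficients are found from
the last one to the first.  A new first term [c0 *: q 0] lies in all the later
[W k] and leaves their distances unchanged; [dist_adjust] chooses [c0] to
correct the distance to [W 0], which so far is at most [2 * a 1 <= a 0] by
telescoping. *)
Lemma prescribed_dist (R : realType) (X : normedModType R) (m : nat)
    (W : nat -> set X) (q : nat -> X) (a : nat -> R) :
  (forall j, linear_subspace (W j)) ->
  (forall i j, (i < j)%N -> W j (q i)) ->
  (forall j, 1 <= dist (q j) (W j)) ->
  (forall j, 0 <= a j) ->
  (forall j, 2 * a j.+1 <= a j) ->
  (forall j, a j * `|q j| <= 2 * a j - 2 * a j.+1) ->
  exists2 c : nat -> R, (forall j, `|c j| <= a j) &
    forall k, (k < m)%N -> dist (\sum_(0 <= j < m) c j *: q j) (W k) = a k.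
Proof.
elim: m W q a => [|m IH] W q a W_sub qW q1 a0 a2 aq.
  by exists (fun=> 0) => // j; rewrite normr0.
have [||||||c ca cW] := IH (W \o succn) (q \o succn) (a \o succn) => //=.
  by move=> i j ij; exact: qW.
set y := \sum_(0 <= j < m) c j *: q j.+1 in cW.
have ya : dist y (W 0%N) <= a 0%N.
  apply: le_trans (dist_le_norm (W_sub _) _) (le_trans _ (a2 0%N)).
  apply: (sum_le_telescope (b := fun j => 2 * a j.+1)) => j.
    by rewrite normrZ; apply: le_trans (aq j.+1); rewrite ler_wpM2r.
  by rewrite mulr_ge0.
have [c0 c0a c0y] := dist_adjust (W_sub 0%N) (q1 0%N) ya.
exists (fun j => if j is i.+1 then c i else c0); first by case.
move=> k km; rewrite big_nat_recl//=.
case: k km => [//|k km]; rewrite dist_translate ?cW//.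
by apply: subspaceZ => //; exact: qW.
Qed.

(** * Convergence along an ultrafilter *)

Lemma fmap_ultra (T S : Type) (U : set_system T) (f : T -> S) :
  UltraFilter U -> UltraFilter (f @ U).
Proof.
move=> UU; split; first exact: fmap_proper_filter.
move=> G GG fUG; apply/seteqP; split=> A; last exact: fUG.
move=> GA; have [//|UA] := in_ultra_setVsetC (f @^-1` A) UU.
have /filter_ex[y []//] : G (A `&` ~` A).
by apply: filterI => //; exact: fUG.
Qed.

Lemma ultra_bounded_cvg (R : realType) (T : Type) (U : set_system T)
    (f : T -> R) (a : R) :
  UltraFilter U -> (forall i, `|f i| <= a) -> exists l : R, f @ U --> l.
Proof.
move=> UU fa; have := @segment_compact R (- a) a.
rewrite compact_ultra => /(_ _ (fmap_ultra f UU))[|l [_ fl]]; last by exists l.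
by apply: (@filterE _ U) => i; rewrite /preimage/= in_itv/= -ler_norml.
Qed.

Lemma cvg_sum_nat (R : realType) (X : normedModType R) (T : Type)
    (U : set_system T) (f : nat -> T -> X) (l : nat -> X) n : Filter U ->
  (forall j, f j @ U --> l j) ->
  (\sum_(0 <= j < n) f j t) @[t --> U] --> \sum_(0 <= j < n) l j.
Proof.
move=> UF fl; elim: n => [|n IH].
  rewrite big_geq//; under eq_fun do rewrite big_geq//; exact: cvg_cst.
rewrite big_nat_recr//=; under eq_fun do rewrite big_nat_recr//=.
exact: cvgD.
Qed.

(** For a fixed [M] the first [M] terms converge along [U], because their
coefficients stay in compact intervals.  The rest has norm at most [b M], which
is as small as desired, so the image of [U] is a Cauchy filter. *)
Lemma ultra_series_cvg (R : realType) (X : completeNormedModType R)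
    (U : set_system nat) (c : nat -> nat -> R) (q : nat -> X)
    (a b : nat -> R) :
  UltraFilter U -> \oo `<=` U ->
  (forall m j, `|c m j| <= a j) ->
  (forall m M, `|\sum_(M <= j < m) c m j *: q j| <= b M) ->
  (forall r, 0 < r -> exists M, b M < r) ->
  exists x : X, (\sum_(0 <= j < m) c m j *: q j) @[m --> U] --> x.
Proof.
move=> UU oU ca tail b0; suff /cauchy_cvg/cvg_ex[x] :
    cauchy ((fun m => \sum_(0 <= j < m) c m j *: q j) @ U) by exists x.
apply: cauchy_exP => r r0.
have r2 : 0 < r / 2 by rewrite divr_gt0.
have [M bM] := b0 _ r2.
have /choice[l cl] : forall j, exists l : R, c m j @[m --> U] --> l.
  by move=> j; apply: (@ultra_bounded_cvg R nat U _ (a j)).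
have Sl : \sum_(0 <= j < M) c m j *: q j @[m --> U] -->
          \sum_(0 <= j < M) l j *: q j.
  by apply: cvg_sum_nat => j; exact: cvgZr_tmp.
exists (\sum_(0 <= j < M) l j *: q j).
suff : \forall m \near U,
    ball (\sum_(0 <= j < M) l j *: q j) r (\sum_(0 <= j < m) c m j *: q j) by [].
have Mm : \forall m \near U, (M <= m)%N by apply: oU; exists M.
near=> m; rewrite -ball_normE /=.
rewrite [X in _ - X](big_cat_nat (n := M))//=; last by near: m.
have := tail m M.
have : `|\sum_(0 <= j < M) l j *: q j - \sum_(0 <= j < M) c m j *: q j| < r / 2.
  by near: m; apply: cvgr_dist_lt.
rewrite opprD addrA => ? ?; apply: le_lt_trans (ler_normB _ _) _; lra.
Unshelve. all: by end_near. Qed.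

(** * Blocks of indices *)

(** Take for [s j.+1] the first index at which [e] is below half of [e (s j)].
There is one because [e] tends to 0, and it comes after [s j] because [e] is
nonincreasing. *)
Lemma halving_blocks (R : realType) (e : nat -> R) :
  (forall n, 0 < e n) -> nonincreasing_seq e -> e @ \oo --> (0 : R) ->
  exists s : nat -> nat, [/\ s 0%N = 0%N, (forall j, s j < s j.+1)%N,
    (forall j, 2 * e (s j.+1) < e (s j)) &
    (forall j n, (s j <= n < s j.+1)%N -> e (s j) <= 2 * e n)].
Proof.
move=> e_pos e_noninc e0.
have drop i : exists n, 2 * e n < e i.
  have ei : 0 < e i / 2 by rewrite divr_gt0.
  have [N _ /(_ N (leqnn N))] := (cvgrPdist_lt _ _).1 e0 _ ei.
  by rewrite sub0r normrN gtr0_norm// => ?; exists N; lra.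
pose next i := ex_minn (drop i).
exists (fun j => iter j next 0%N); split=> //= [j|j|j n].
- rewrite {2}/next; case: ex_minnP => n en _.
  rewrite ltnNge; apply/negP => /e_noninc; have := e_pos n; move: en; lra.
- by rewrite {1}/next; case: ex_minnP.
- rewrite {2}/next; case: ex_minnP => k _ kmin /andP[_ nk].
  rewrite leNgt; apply/negP => /kmin; rewrite leqNgt nk; exact/negP.
Qed.

Lemma block_ex (s : nat -> nat) n : s 0%N = 0%N -> (forall j, s j < s j.+1)%N ->
  exists j, (s j <= n < s j.+1)%N.
Proof.
move=> s0 s_lt; elim: n => [|n [j /andP[jn nj]]].
  by exists 0%N; rewrite s0 leqnn -{1}s0 s_lt.
have [nj'|nj'] := ltnP n.+1 (s j.+1); first by exists j; rewrite (leqW jn) nj'.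
have -> : n.+1 = s j.+1 by apply/eqP; rewrite eqn_leq nj nj'.
by exists j.+1; rewrite leqnn s_lt.
Qed.

(** * The prescribed deviations *)

Theorem theorem2p18 (R : realType) (X : completeNormedModType R)
    (V : nat -> set X) (e : nat -> R)
    (V_subspace : forall n, linear_subspace (V n))
    (V_nested : forall n, V n `<=` V n.+1)
    (V_strict : forall n, closure (V n) `<` V n.+1)
    (e_pos : forall n, 0 < e n)
    (e_decreasing : nonincreasing_seq e)
    (e_cvg0 : e @ \oo --> (0 : R)) :
  exists x : X, forall n, e n / 2 <= dist x (V n) <= 2 * e n.
Proof.
have V_mono i j : (i <= j)%N -> V i `<=` V j.
  move/subnK <-; elim: (j - i)%N => [//|k IH].
  by rewrite addSn; exact: subset_trans (V_nested _).
have [s [s0 s_lt s_half s_block]] := halving_blocks e_pos e_decreasing e_cvg0.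
have s_mono i j : (i <= j)%N -> (s i <= s j)%N.
  move/subnK <-; elim: (j - i)%N => [//|k IH].
  by rewrite addSn (leq_trans IH)// ltnW.
have s_ge j : (j <= s j)%N by elim: j => // j /leq_ltn_trans; exact.
have s_pos j : (0 < s j.+1)%N by exact: leq_trans (s_ge _).
pose a j := e (s j) / 2; pose W j := V (s j.+1).-1.
have a_pos j : 0 < a j by rewrite divr_gt0.
have a_half j : 2 * a j.+1 < a j by have := s_half j; rewrite /a; lra.
have /choice[q /all_and3[qV q1 qa]] : forall j, exists q,
    [/\ V (s j.+1) q, 1 <= dist q (W j) & a j * `|q| <= 2 * a j - 2 * a j.+1].
  move=> j.
  have [u Vu u_cl] : exists2 u, V (s j.+1) u & ~ closure (W j) u.
    have := V_strict (s j.+1).-1; rewrite prednK// => -[_ nVV].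
    by apply/not_exists2P => H; apply: nVV => u Vu; case: (H u) => // /contrapT.
  (* Room for the norm of [q j], because [e] more than halves at [s j.+1]. *)
  have t1 : 1 < (2 * a j - 2 * a j.+1) / a j.
    by rewrite ltr_pdivlMr// mul1r; have := a_half j; lra.
  have [v [c [Wv q1 qt]]] := riesz (V_subspace _) u_cl t1.
  exists (c *: (u - v)); split=> //.
    apply: subspaceZ => //; apply: subspaceD => //; apply: subspaceN => //.
    by apply: V_mono Wv; exact: leq_pred.
  by rewrite mulrC -ler_pdivlMr.
have qW i j : (i < j)%N -> W j (q i).
  move=> ij; apply: V_mono (qV i); rewrite -ltnS prednK//.
  by apply: leq_ltn_trans (s_lt j); exact: s_mono.
have /choice[c /all_and2[ca cW]] : forall m, exists c : nat -> R,
    (forall j, `|c j| <= a j) /\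
    forall k, (k < m)%N -> dist (\sum_(0 <= j < m) c j *: q j) (W k) = a k.
  move=> m; have [||||||c ? ?] := @prescribed_dist R X m W q a; last by exists c.
  - by move=> j; exact: V_subspace.
  - exact: qW.
  - exact: q1.
  - by move=> j; exact: ltW.
  - by move=> j; exact: ltW.
  - exact: qa.
pose S m := \sum_(0 <= j < m) c m j *: q j.
have tail m k n : `|\sum_(k <= j < n) c m j *: q j| <= 2 * a k.
  apply: (sum_le_telescope (b := fun j => 2 * a j)) => j.
    by rewrite normrZ; apply: le_trans (qa j); rewrite ler_wpM2r.
  by rewrite mulr_ge0// ltW.
have S_bounds n : \forall m \near \oo, e n / 2 <= dist (S m) (V n) <= 2 * e n.
  have [j jn] := block_ex n s0 s_lt; have := s_block _ _ jn.
  case/andP: jn => jn nj en; exists j.+1 => // m /= jm; apply/andP; split.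
    apply: (@le_trans _ _ (a j)); first by rewrite /a ler_pM2r// e_decreasing.
    rewrite -(cW m j jm); apply: distS; first exact: subspace_neq0.
    by apply: V_mono; rewrite -ltnS prednK.
  rewrite /S (big_cat_nat (n := j))//=; last exact: ltnW.
  rewrite dist_translate//; last first.
    apply: subspace_sum => // i; rewrite mem_index_iota => /andP[_ ij].
    apply: subspaceZ => //; apply: V_mono (qV i).
    by apply: leq_trans jn; exact: s_mono.
  apply: le_trans (dist_le_norm _ _) _ => //; apply: le_trans (tail _ _ _) _.
  by rewrite /a mulrC divfK.
have [U [UU oU]] := @ultraFilterLemma nat \oo _.
have [||x Sx] := @ultra_series_cvg R X U c q a (fun j => 2 * a j) UU oU ca.
- by move=> m M; exact: tail.
- move=> r r0; have [N _ /(_ N (leqnn N))] := (cvgrPdist_lt _ _).1 e_cvg0 _ r0.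
  rewrite sub0r normrN gtr0_norm// => eN; exists N; rewrite /a mulrC divfK//.
  by apply: le_lt_trans eN; exact/e_decreasing.
exists x => n.
have dx : dist (S m) (V n) @[m --> U] --> dist x (V n).
  exact: (cvg_comp S (fun y => dist y (V n)) Sx
    (dist_continuous (subspace_neq0 (V_subspace n)) (x := x))).
have U_bounds : \forall m \near U,
    `[e n / 2, 2 * e n]%classic (dist (S m) (V n)).
  by apply: oU; apply: filterS (S_bounds n) => m; rewrite /= in_itv.
suff : `[e n / 2, 2 * e n]%classic (dist x (V n)) by rewrite /= in_itv.
exact: (closed_cvg _ (@itv_closed _ _ _ _) U_bounds _ dx).
Qed.
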